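(* Consider the Heisenberg group $\mathbb{H}^1$ identified with $\mathbb{R}^3$ with coordinates $(x,y,z)=(x_1,x_2,x_3)$, with $$a^{\mathsf T}=\begin{pmatrix}1&0&-y/2\\0&1&x/2\end{pmatrix},\qquad z^{\mathsf T}=(0,0,1),$$ a potential $V\in C^\infty(\mathbb{R}^3)$ and $\rho^*=\frac1c e^{-V}$. For every $f\in C^\infty(\mathbb{H}^1)$ one has $$\Gamma_2(f,f)+\Gamma_2^{z,\rho^*}(f,f)=|\mathfrak{Hess}_{a,z}f|^2+\mathfrak R(\nabla f,\nabla f),\qquad \mathfrak R=\mathfrak R_{ab}^G+\mathfrak R_{zb}+\mathfrak R_{\rho^*},$$ where $$\Lambda_1^{\mathsf T}=(0,0,0,0,0,0,0,0,0),\qquad \Lambda_2^{\mathsf T}=(0,0,0,0,0,0,A_2f,-A_1f,0),$$ and $$\begin{aligned}\mathfrak R^G_{ab}(\nabla f,\nabla f)=&\ \mathfrak R_{ab}(\nabla f,\nabla f)-\Lambda_1^{\mathsf T}Q^{\mathsf T}Q\Lambda_1-\Lambda_2^{\mathsf T}P^{\mathsf T}P\Lambda_2+D^{\mathsf T}D+E^{\mathsf T}E\\ =&-\Gamma_1(f,f)+\tfrac12\Gamma_1^z(f,f)-(A_1V)\,\partial_zf\,(A_2f)+(A_2V)\,\partial_zf\,(A_1f)\\ &+\Big[\partial_x^2V+\tfrac{y^2}{4}\partial_z^2V-y\,\partial_x\partial_zV\Big]|A_1f|^2+\Big[\partial_y^2V+\tfrac{x^2}{4}\partial_z^2V+x\,\partial_y\partial_zV\Big]|A_2f|^2\\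 &+2\Big[\partial_x\partial_yV+\tfrac x2\partial_x\partial_zV-\tfrac y2\partial_y\partial_zV-\tfrac{xy}{4}\partial_z^2V\Big](A_1f)(A_2f),\end{aligned}$$ $$\mathfrak R_{zb}(\nabla f,\nabla f)=\Big(\partial_x\partial_zV-\tfrac y2\partial_z^2V\Big)(A_1f)(\mathsf Zf)+\Big(\partial_y\partial_zV+\tfrac x2\partial_z^2V\Big)(\mathsf Zf)(A_2f),\qquad \mathfrak R_{\rho^*}(\nabla f,\nabla f)=0.$$ Here $A_1f=\partial_xf-\frac y2\partial_zf$, $A_2f=\partial_yf+\frac x2\partial_zf$, $\mathsf Zf=\partial_zf$.
   Context: General notation (here $n=2$, $m=1$). $a$ is a smooth $3\times2$ matrix function and $z$ a smooth $3\times1$ matrix function on $\mathbb{R}^3$ (the matrix $z$ is not to be confused with the coordinate $z$). Write $\partial_p=\partial/\partial x_p$, $\alpha_{ip}=(a^{\mathsf T})_{ip}$, $\zeta_p=(z^{\mathsf T})_{1p}$; indices $i,k$ run over $\{1,2\}$ and $p,q,r,s$ over $\{1,2,3\}$; a derivative acts only on the factor immediately following it. $A_if=(a^{\mathsf T}\nabla)_if=\sum_p\alpha_{ip}\partial_pf$, $\mathsf Zf=(z^{\mathsf T}\nabla)_1f=\sum_p\zeta_p\partial_pf$. Generator: $Lf=\nabla\cdot(aa^{\mathsf T}\nabla f)-\langle a\otimes\nabla a,\nabla f\rangle-\langle\nabla V,aa^{\mathsf T}\nabla f\rangle$, with $(a\otimes\nabla a)_p=\sum_{k}\sum_{q}\alpha_{kp}\partial_q\alpha_{kq}$.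 $\rho^*=\frac1c e^{-V}$ with $c=\int e^{-V}dx<\infty$ (here $\mathrm{Vol}=1$). Gamma forms: $\Gamma_1(f,g)=\sum_iA_if\,A_ig$, $\Gamma_1^z(f,g)=\mathsf Zf\,\mathsf Zg$, $\Gamma_2(f,f)=\frac12[L\Gamma_1(f,f)-2\Gamma_1(Lf,f)]$, and $$\Gamma_2^{z,\rho^*}(f,f)=\tfrac12[L\Gamma_1^z(f,f)-2\Gamma_1^z(Lf,f)]+\tfrac1{\rho^*}\nabla\cdot\big(\rho^*zz^{\mathsf T}\langle\nabla f,\nabla(aa^{\mathsf T})\nabla f\rangle\big)-\tfrac1{\rho^*}\nabla\cdot\big(\rho^*aa^{\mathsf T}\langle\nabla f,\nabla(zz^{\mathsf T})\nabla f\rangle\big),$$ where $\langle\nabla f,\nabla(M)\nabla f\rangle$ denotes the vector with $p$-th component $\langle\nabla f,(\partial_pM)\nabla f\rangle$. Matrices and vectors: pairs $(p,q)$ are ordered lexicographically. $X\in\mathbb{R}^9$ has entries $X_{pq}=\partial_p\partial_qf$. $Q\in\mathbb{R}^{4\times9}$ has entries $Q_{(i,k),(p,q)}=\alpha_{ip}\alpha_{kq}$ (rows $(i,k)$ in lexicographic order). $P\in\mathbb{R}^{2\times9}$ has entries $P_{k,(p,q)}=\zeta_p\alpha_{kq}$. $D\in\mathbb{R}^4$: $D_{ik}=\sum_{p,r}\alpha_{ip}\,\partial_p\alpha_{kr}\,\partial_rf$. $E\in\mathbb{R}^2$: $E_i=\sum_{p,r}\alpha_{ip}\,\partial_p\zeta_r\,\partial_rf$.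 For given $\Lambda_1,\Lambda_2\in\mathbb{R}^9$, $$|\mathfrak{Hess}_{a,z}f|^2=(X+\Lambda_1)^{\mathsf T}Q^{\mathsf T}Q(X+\Lambda_1)+(X+\Lambda_2)^{\mathsf T}P^{\mathsf T}P(X+\Lambda_2).$$ Tensors: let $b=-\frac12aa^{\mathsf T}\nabla V$. Then $$\mathfrak R_{ab}(\nabla f,\nabla f)=\sum_{i,k}\sum_{p,q,r}\big[\alpha_{ip}\partial_p\alpha_{iq}\,\partial_q\alpha_{kr}\,\partial_rf+\alpha_{ip}\alpha_{iq}(\partial_p\partial_q\alpha_{kr})\partial_rf-\alpha_{kr}\partial_r\alpha_{ip}\,\partial_p\alpha_{iq}\,\partial_qf-\alpha_{kr}\alpha_{ip}(\partial_r\partial_p\alpha_{iq})\partial_qf\big]A_kf-2\sum_i\sum_{q,r}\big(\alpha_{iq}\partial_qb_r\,\partial_rf-b_r\partial_r\alpha_{iq}\,\partial_qf\big)A_if,$$ $$\mathfrak R_{zb}(\nabla f,\nabla f)=\sum_i\sum_{p,q,r}\big[\alpha_{ip}\partial_p\alpha_{iq}\,\partial_q\zeta_r\,\partial_rf+\alpha_{ip}\alpha_{iq}(\partial_p\partial_q\zeta_r)\partial_rf-\zeta_r\partial_r\alpha_{ip}\,\partial_p\alpha_{iq}\,\partial_qf-\zeta_r\alpha_{ip}(\partial_r\partial_p\alpha_{iq})\partial_qf\big]\mathsf Zf-2\sum_{q,r}\big(\zeta_q\partial_qb_r\,\partial_rf-b_r\partial_r\zeta_q\,\partial_qf\big)\mathsf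 Zf,$$ $$\begin{aligned}\mathfrak R_{\rho^*}(\nabla f,\nabla f)=&\ 2\sum_i\sum_{p,q,r,s}\big[(\partial_p\zeta_p)\zeta_q(\partial_q\alpha_{ir})\alpha_{is}+\zeta_p(\partial_p\zeta_q)(\partial_q\alpha_{ir})\alpha_{is}+\zeta_p\zeta_q(\partial_p\partial_q\alpha_{ir})\alpha_{is}+\zeta_p\zeta_q(\partial_q\alpha_{ir})(\partial_p\alpha_{is})\big]\partial_rf\,\partial_sf\\&+2\sum_i\sum_{q,r,s}(\mathsf Z\log\rho^* )\zeta_q(\partial_q\alpha_{ir})\alpha_{is}\,\partial_rf\,\partial_sf\\&-2\sum_i\sum_{p,q,r,s}\big[(\partial_p\alpha_{ip})\alpha_{iq}(\partial_q\zeta_r)\zeta_s+\alpha_{ip}(\partial_p\alpha_{iq})(\partial_q\zeta_r)\zeta_s+\alpha_{ip}\alpha_{iq}(\partial_p\partial_q\zeta_r)\zeta_s+\alpha_{ip}\alpha_{iq}(\partial_q\zeta_r)(\partial_p\zeta_s)\big]\partial_rf\,\partial_sf\\&-2\sum_i\sum_{q,r,s}(A_i\log\rho^* )\alpha_{iq}(\partial_q\zeta_r)\zeta_s\,\partial_rf\,\partial_sf.\end{aligned}$$ *)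

(* Defs.v *)
From HB Require Import structures.
From mathcomp Require Import all_boot all_order all_algebra.
From mathcomp Require Import mxtens.
From mathcomp Require Import all_classical all_reals all_analysis.

Set Implicit Arguments.
Unset Strict Implicit.
Unset Printing Implicit Defensive.

Import Order.TTheory GRing.Theory Num.Theory.
Import numFieldNormedType.Exports.

Local Open Scope classical_set_scope.
Local Open Scope ring_scope.

(* Points of R^3 are row vectors u with coordinates u 0 0, u 0 1, u 0 2;       *)
(* vector fields and gradients are column vectors.  All indices start at 0,    *)
(* so A_1, A_2 are Aop a 0, Aop a 1 and the coordinates x, y, z are numbered   *)
(* 0, 1, 2.                                                                    *)
Section Calculus.
Context {R : realType}.
Implicit Types (f g : 'rV[R]_3 -> R) (u : 'rV[R]_3).

Definition partial (p : 'I_3) f u : R := 'D_(delta_mx 0 p) f u.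

(* foldr partial f [:: p1; ...; pk] is the iterated partial derivative of f    *)
(* along p1, ..., pk; the case s = [::] says that f itself is continuous.      *)
Definition smooth f : Prop :=
  forall s : seq 'I_3,
    continuous (foldr partial f s) /\
    forall p u, derivable (foldr partial f s) u (delta_mx 0 p).

Definition grad f u : 'cV[R]_3 := \col_p partial p f u.

Definition div (v : 'rV[R]_3 -> 'cV[R]_3) u : R :=
  \sum_p partial p (fun w => v w p 0) u.

Definition dot n (v w : 'cV[R]_n) : R := (v^T *m w) 0 0.

Definition partial_mx m n (p : 'I_3) (M : 'rV[R]_3 -> 'M[R]_(m, n)) u
    : 'M[R]_(m, n) :=
  \matrix_(r, s) partial p (fun w => M w r s) u.

(* The vector <grad f, grad(M) grad f>.                                        *)
Definition grad_quad f (M : 'rV[R]_3 -> 'M[R]_3) u : 'cV[R]_3 :=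
  \col_p dot (grad f u) (partial_mx p M u *m grad f u).

Definition lebesgue3 := ((@lebesgue_measure R \x @lebesgue_measure R)
                           \x @lebesgue_measure R)%E.

Definition point3 (t : R * R * R) : 'rV[R]_3 :=
  \row_j [:: t.1.1; t.1.2; t.2]`_j.

Definition gibbs_mass (V : 'rV[R]_3 -> R) : \bar R :=
  (\int[lebesgue3]_t (expR (- V (point3 t)))%:E)%E.

Definition gibbs (V : 'rV[R]_3 -> R) u : R :=
  (fine (gibbs_mass V))^-1 * expR (- V u).

End Calculus.

Section Gamma.
Context {R : realType}.
Variables (a : 'rV[R]_3 -> 'M[R]_(3, 2)) (z : 'rV[R]_3 -> 'cV[R]_3).
Variables (V rho : 'rV[R]_3 -> R).
Implicit Types (f g : 'rV[R]_3 -> R) (u : 'rV[R]_3).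

Definition alpha (i : 'I_2) (p : 'I_3) u : R := (a u)^T i p.
Definition zeta (p : 'I_3) u : R := (z u)^T 0 p.

Definition Aop (i : 'I_2) f u : R := ((a u)^T *m grad f u) i 0.
Definition Zop f u : R := ((z u)^T *m grad f u) 0 0.

Definition aaT u : 'M[R]_3 := a u *m (a u)^T.
Definition zzT u : 'M[R]_3 := z u *m (z u)^T.

Definition a_tensor_grad_a u : 'cV[R]_3 :=
  \col_p \sum_k \sum_q alpha k p u * partial q (alpha k q) u.

Definition Lop f u : R :=
  div (fun w => aaT w *m grad f w) u
  - dot (a_tensor_grad_a u) (grad f u)
  - dot (grad V u) (aaT u *m grad f u).

Definition Gamma1 f g u : R := \sum_i Aop i f u * Aop i g u.
Definition Gamma1z f g u : R := Zop f u * Zop g u.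

Definition Gamma2 f u : R :=
  2^-1 * (Lop (Gamma1 f f) u - 2 * Gamma1 (Lop f) f u).

Definition Gamma2z_rho f u : R :=
  2^-1 * (Lop (Gamma1z f f) u - 2 * Gamma1z (Lop f) f u)
  + (rho u)^-1 * div (fun w => rho w *: (zzT w *m grad_quad f aaT w)) u
  - (rho u)^-1 * div (fun w => rho w *: (aaT w *m grad_quad f zzT w)) u.

(* mxtens_unindex decodes a position in 'I_(m * n) as the pair (i, j) at that  *)
(* position in lexicographic order.                                            *)
Definition Xvec f u : 'cV[R]_(3 * 3) :=
  \col_c partial (mxtens_unindex c).1 (partial (mxtens_unindex c).2 f) u.

Definition Qmx u : 'M[R]_(2 * 2, 3 * 3) :=
  \matrix_(r, c) (alpha (mxtens_unindex r).1 (mxtens_unindex c).1 u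
                  * alpha (mxtens_unindex r).2 (mxtens_unindex c).2 u).

Definition Pmx u : 'M[R]_(2, 3 * 3) :=
  \matrix_(k, c) (zeta (mxtens_unindex c).1 u
                  * alpha k (mxtens_unindex c).2 u).

Definition Dvec f u : 'cV[R]_(2 * 2) :=
  \col_c \sum_p \sum_r
     alpha (mxtens_unindex c).1 p u
     * partial p (alpha (mxtens_unindex c).2 r) u * partial r f u.

Definition Evec f u : 'cV[R]_2 :=
  \col_i \sum_p \sum_r alpha i p u * partial p (zeta r) u * partial r f u.

Definition gram_form m n (M : 'M[R]_(m, n)) (v : 'cV[R]_n) : R :=
  (v^T *m M^T *m M *m v) 0 0.

(* |Hess_{a,z} f|^2, for given Lambda_1 = L1 and Lambda_2 = L2.                *)
Definition hess_sq (L1 L2 : 'cV[R]_(3 * 3)) f u : R :=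
  gram_form (Qmx u) (Xvec f u + L1) + gram_form (Pmx u) (Xvec f u + L2).

Definition bvec u : 'cV[R]_3 := - 2^-1 *: (aaT u *m grad V u).

Definition R_ab f u : R :=
  (\sum_i \sum_k (\sum_p \sum_q \sum_r
     (alpha i p u * partial p (alpha i q) u
        * partial q (alpha k r) u * partial r f u
      + alpha i p u * alpha i q u
        * partial p (partial q (alpha k r)) u * partial r f u
      - alpha k r u * partial r (alpha i p) u
        * partial p (alpha i q) u * partial q f u
      - alpha k r u * alpha i p u
        * partial r (partial p (alpha i q)) u * partial q f u)) * Aop k f u)
  - 2 * \sum_i (\sum_q \sum_r
     (alpha i q u * partial q (fun w => bvec w r 0) u * partial r f u
      - bvec u r 0 * partial r (alpha i q) u * partial q f u)) * Aop i f u.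

Definition R_zb f u : R :=
  (\sum_i (\sum_p \sum_q \sum_r
     (alpha i p u * partial p (alpha i q) u
        * partial q (zeta r) u * partial r f u
      + alpha i p u * alpha i q u
        * partial p (partial q (zeta r)) u * partial r f u
      - zeta r u * partial r (alpha i p) u
        * partial p (alpha i q) u * partial q f u
      - zeta r u * alpha i p u
        * partial r (partial p (alpha i q)) u * partial q f u)) * Zop f u)
  - 2 * (\sum_q \sum_r
     (zeta q u * partial q (fun w => bvec w r 0) u * partial r f u
      - bvec u r 0 * partial r (zeta q) u * partial q f u)) * Zop f u.

Definition R_rho f u : R :=
  2 * (\sum_i \sum_p \sum_q \sum_r \sum_s
     (partial p (zeta p) u * zeta q u
        * partial q (alpha i r) u * alpha i s u
      + zeta p u * partial p (zeta q) u
        * partial q (alpha i r) u * alpha i s u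
      + zeta p u * zeta q u
        * partial p (partial q (alpha i r)) u * alpha i s u
      + zeta p u * zeta q u
        * partial q (alpha i r) u * partial p (alpha i s) u)
     * partial r f u * partial s f u)
  + 2 * (\sum_i \sum_q \sum_r \sum_s
     Zop (fun w => ln (rho w)) u * zeta q u
     * partial q (alpha i r) u * alpha i s u * partial r f u * partial s f u)
  - 2 * (\sum_i \sum_p \sum_q \sum_r \sum_s
     (partial p (alpha i p) u * alpha i q u
        * partial q (zeta r) u * zeta s u
      + alpha i p u * partial p (alpha i q) u
        * partial q (zeta r) u * zeta s u
      + alpha i p u * alpha i q u
        * partial p (partial q (zeta r)) u * zeta s u
      + alpha i p u * alpha i q u
        * partial q (zeta r) u * partial p (zeta s) u)
     * partial r f u * partial s f u)
  - 2 * (\sum_i \sum_q \sum_r \sum_s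
     Aop i (fun w => ln (rho w)) u * alpha i q u
     * partial q (zeta r) u * zeta s u * partial r f u * partial s f u).

Definition RG_ab (L1 L2 : 'cV[R]_(3 * 3)) f u : R :=
  R_ab f u - gram_form (Qmx u) L1 - gram_form (Pmx u) L2
  + dot (Dvec f u) (Dvec f u) + dot (Evec f u) (Evec f u).

Definition R_total (L1 L2 : 'cV[R]_(3 * 3)) f u : R :=
  RG_ab L1 L2 f u + R_zb f u + R_rho f u.

End Gamma.

Section Heisenberg.
Context {R : realType}.

Definition heis_aT (u : 'rV[R]_3) : 'M[R]_(2, 3) :=
  \matrix_(i, p) (nth [::] [:: [:: 1; 0; - (u 0 1 / 2)];
                               [:: 0; 1; u 0 0 / 2]] i)`_p.
Definition heis_a (u : 'rV[R]_3) : 'M[R]_(3, 2) := (heis_aT u)^T.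

Definition heis_zT (u : 'rV[R]_3) : 'rV[R]_3 := \row_p [:: 0; 0; 1]`_p.
Definition heis_z (u : 'rV[R]_3) : 'cV[R]_3 := (heis_zT u)^T.

Definition heis_Lambda1 : 'cV[R]_(3 * 3) :=
  \col_c [:: 0; 0; 0; 0; 0; 0; 0; 0; 0]`_c.
Definition heis_Lambda2 (f : 'rV[R]_3 -> R) (u : 'rV[R]_3)
    : 'cV[R]_(3 * 3) :=
  \col_c [:: 0; 0; 0; 0; 0; 0; Aop heis_a 1 f u; - Aop heis_a 0 f u; 0]`_c.

End Heisenberg.

(* Main.v *)
Require Import Defs.
From mathcomp Require Import all_boot all_order all_algebra.
From mathcomp Require Import mxtens ring.
From mathcomp Require Import all_classical all_reals all_analysis.

(* Partial derivatives of smooth functions commute (Schwarz), so smooth       *)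
(* functions form a commutative algebra on which A_1, A_2, Z act as           *)
(* derivations with [A_1, A_2] = Z and Z central.  For any smooth a,          *)
(* L f = sum_k (A_k A_k f - A_k V A_k f), hence the Bochner-type identity     *)
(*   Gamma2 f = sum_k Gamma1(A_k f) + A_k f * [L, A_k] f,                     *)
(* and similarly for Z; the commutators [L, A_k] produce the cross terms      *)
(* A_i Z f * A_k f, which Lambda_2 absorbs into a completed square.           *)
(* Second-order terms are matched through A_i A_k f = (Q X)_ik + D_ik, where  *)
(* D is antisymmetric with D_12 = Z f / 2.  The divergence terms of           *)
(* Gamma_2^{z,rho} vanish because a a^T does not depend on the third          *)
(* coordinate and z is constant.                                              *)

Import Order.TTheory GRing.Theory Num.Theory.
Import numFieldNormedType.Exports.

Local Open Scope ring_scope.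

(** * Symmetry of second derivatives *)

(** In the frame A_0, A_1, Z both sides become polynomials in values of iterated frame derivatives
    of f and V, and the theorem is a comparison of these polynomials. Up to terms in V, [L, A_0] f =
    -2 A_1 Z f and [L, A_1] f = 2 A_0 Z f. Hence [Gamma2_heis] gives the sum of the (A_i A_k f)^2,
    terms in V, and the cross terms 2 (A_0 Z f A_1 f - A_1 Z f A_0 f). Since Z is central,
    [Gamma2z_heis] adds only the (A_i Z f)^2 and terms in V. Two corrections produce the squares of
    [hess_sq_heis]. The squares (A_0 Z f + A_1 f)^2 and (A_1 Z f - A_0 f)^2 absorb the cross terms
    at the cost of |P Lambda_2|^2 = Gamma_1(f,f), whence -Gamma_1 in the tensor. Replacing A_i A_k f
    by its symmetrisation Q X lowers the sum of squares by |D|^2 = (Z f)^2 / 2, whence +Gamma_1^z /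
    2. The terms in V are brackets of the frame with the drift b = -1/2 sum_k (A_k V) a e_k
    ([drift_bracket], [R_ab_heis], [R_zb_heis]); expanding A_i A_k V in coordinates gives the
    displayed Hessian of V. *)

Section Schwarz.
Local Open Scope classical_set_scope.
Context {R : realType} {U : normedModType R}.
Implicit Types (f : U -> R) (u v w : U).

Lemma is_derive_line f u v (t : R) : derivable f (u + t *: v) v ->
  is_derive t 1 (fun s => f (u + s *: v)) ('D_v f (u + t *: v)).
Proof.
have E : (fun h : R => h^-1 *:
      (((fun s => f (u + s *: v)) \o shift t) (h *: (1:R)) - f (u + t *: v)))
  = (fun h => h^-1 *: ((f \o shift (u + t *: v)) (h *: v) - f (u + t *: v))).
  apply/funext => h /=; congr (_ *: (f _ - _)).
  by rewrite [h *: 1]mulr1 scalerDl addrCA.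
move=> df; split; first by rewrite /derivable E.
by rewrite /derive E.
Qed.

Lemma MVT_line f u v (h : R) : 0 < h -> (forall x, derivable f x v) ->
  exists2 c, c \in `]0, h[%R & f (u + h *: v) - f u = 'D_v f (u + c *: v) * h.
Proof.
move=> h0 df.
have [|c ch] := @MVT _ (fun s => f (u + s *: v)) (fun s => 'D_v f (u + s *: v))
   0 h h0 (fun x _ => is_derive_line _ _ _ x (df _)).
  apply: derivable_within_continuous => x _.
  by have [] := is_derive_line _ u v x (df _).
by rewrite scale0r addr0 subr0 => ->; exists c.
Qed.

(** The mean value theorem is applied to x -> f (x + h w) - f x along v, then to ['D_v f] along w.
    The second difference is symmetric in v and w, which is the source of Schwarz's theorem. *)
Lemma second_difference f u v w (h : R) : 0 < h ->
  (forall x, derivable f x v) -> (forall x, derivable ('D_v f) x w) ->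
  exists2 s, s \in `]0, h[%R & exists2 t, t \in `]0, h[%R &
    f (u + h *: v + h *: w) - f (u + h *: v) - f (u + h *: w) + f u
    = 'D_w ('D_v f) (u + s *: v + t *: w) * h ^+ 2.
Proof.
move=> h0 dv dwv.
have shiftD x : derivable (f \o shift (h *: w)) x v
    /\ 'D_v (f \o shift (h *: w)) x = 'D_v f (x + h *: w).
  have E : (fun k : R => k^-1 *: (((f \o shift (h *: w)) \o shift x) (k *: v)
      - (f \o shift (h *: w)) x))
    = (fun k => k^-1 *: ((f \o shift (x + h *: w)) (k *: v) - f (x + h *: w))).
    by apply/funext => k /=; rewrite addrA.
  by split; [rewrite /derivable E; exact: dv | rewrite /derive E].
have dg x : derivable (f \o shift (h *: w) - f) x v.
  by apply: derivableB => //; have [] := shiftD x.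
have [s sh Es] := MVT_line _ u v _ h0 dg.
have [t th Et] := MVT_line _ (u + s *: v) w _ h0 dwv.
exists s => //; exists t => //.
move: Es; rewrite deriveB //; last by have [] := shiftD (u + s *: v).
have [_ ->] := shiftD (u + s *: v).
rewrite Et expr2 mulrA => <-; rewrite !fctE /=; ring.
Qed.

Lemma derive_comm f u v w :
  (forall x, derivable f x v) -> (forall x, derivable f x w) ->
  (forall x, derivable ('D_v f) x w) -> (forall x, derivable ('D_w f) x v) ->
  {for u, continuous ('D_w ('D_v f))} -> {for u, continuous ('D_v ('D_w f))} ->
  'D_v ('D_w f) u = 'D_w ('D_v f) u.
Proof.
move=> dv dw dwv dvw cwv cvw; apply/eqP; rewrite -subr_eq0 -normr_le0.
apply/ler_addgt0Pl => e e0; rewrite addr0; apply/ltW.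
have e20 : 0 < e / 2 by rewrite divr_gt0.
have /cvgrPdist_lt/(_ _ e20)/nbhs_ballP[d1 /= d10 B1] := cwv.
have /cvgrPdist_lt/(_ _ e20)/nbhs_ballP[d2 /= d20 B2] := cvw.
pose d := Num.min d1 d2; have d0 : 0 < d by rewrite lt_min d10 d20.
(* This scale puts every intermediate point of [second_difference] within [d] of u; the extra 1
   keeps the denominator positive even when v = w = 0. *)
pose h := d / (`|v| + `|w| + 1).
have N0 : 0 < `|v| + `|w| + 1 by rewrite ltr_wpDl ?addr_ge0.
have h0 : 0 < h by rewrite divr_gt0.
have near s t : s \in `]0, h[%R -> t \in `]0, h[%R ->
    `|s *: v + t *: w| < d.
  rewrite !in_itv /= => /andP[s0 sh] /andP[t0 th].
  apply: (le_lt_trans (ler_normD _ _)); rewrite !normrZ !gtr0_norm //.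
  have -> : d = h * `|v| + h * `|w| + h.
    by rewrite /h -!mulrDr -[X in _ + X]mulr1 -mulrDr mulfVK // gt_eqF.
  by rewrite ltr_pwDr// lerD// ler_wpM2r// ltW.
have [s sh [t th Est]] := second_difference _ u _ _ _ h0 dv dwv.
have [t' th' [s' sh' Est']] := second_difference _ u _ _ _ h0 dw dvw.
(* Both orders of differentiation compute the same second difference, so the mixed derivatives agree
   at two points near u; continuity then carries this to u up to e. *)
have E : 'D_w ('D_v f) (u + s *: v + t *: w)
    = 'D_v ('D_w f) (u + t' *: w + s' *: v).
  apply: (mulIf (lt0r_neq0 (exprn_gt0 2 h0))); rewrite -Est -Est'.
  by rewrite [u + h *: w + _]addrAC; ring.
have b1 : `|'D_w ('D_v f) u - 'D_v ('D_w f) (u + t' *: w + s' *: v)| < e / 2.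
  rewrite -E; apply: B1; rewrite -ball_normE /ball_ /=.
  rewrite -addrA opprD addNKr normrN.
  by apply: lt_le_trans (near _ _ sh th) _; rewrite ge_min lexx.
have b2 : `|'D_v ('D_w f) u - 'D_v ('D_w f) (u + t' *: w + s' *: v)| < e / 2.
  apply: B2; rewrite -ball_normE /ball_ /=.
  rewrite -addrA opprD addNKr normrN addrC.
  by apply: lt_le_trans (near _ _ sh' th') _; rewrite ge_min lexx orbT.
rewrite distrC in b1.
have := ltrD b2 b1; rewrite -splitr; apply: le_lt_trans.
exact: ler_distD.
Qed.

End Schwarz.

(** * Smooth functions on R^3 *)

Section SmoothFunctions.
Local Open Scope classical_set_scope.
Set Implicit Arguments.
Unset Strict Implicit.
Context {R : realType}.
Implicit Types (f g : 'rV[R]_3 -> R) (u : 'rV[R]_3) (c : R) (p q : 'I_3).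

(* Bounding the number of derivatives makes closure under products an         *)
(* induction on n.                                                            *)
Definition Cn n f : Prop := forall s : seq 'I_3, (size s <= n)%N ->
  continuous (foldr partial f s) /\
  forall p u, derivable (foldr partial f s) u (delta_mx 0 p).

Lemma smoothP f : smooth f <-> forall n, Cn n f.
Proof.
split=> [sf n s _|cf s]; first exact: sf.
exact: (cf (size s)).
Qed.

(** The last element of the list is the innermost derivative; peeling it off makes [Cn] recursive in
    n, the form that the inductions below use. *)
Lemma CnS n f : Cn n.+1 f <-> Cn 0 f /\ forall p, Cn n (partial p f).
Proof.
split=> [cf|[c0 cf] s].
  split=> [s s0|p s sn]; first by apply: cf; exact: leq_trans s0 _.
  have := cf (rcons s p); rewrite size_rcons ltnS foldr_rcons; exact.
case/lastP: s => [_|s p]; first exact: (c0 [::]).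
by rewrite size_rcons ltnS foldr_rcons; apply: cf.
Qed.

Lemma Cn0 f : continuous f -> (forall p u, derivable f u (delta_mx 0 p)) ->
  Cn 0 f.
Proof. by move=> cf df [|//]. Qed.

Lemma CnW n f : Cn n.+1 f -> Cn n f.
Proof. by move=> cf s sn; apply: cf; exact: leqW. Qed.

Lemma Cn_continuous n f : Cn n f -> continuous f.
Proof. by move=> cf; case: (cf [::]). Qed.

Lemma Cn_derivable n f p u : Cn n f -> derivable f u (delta_mx 0 p).
Proof. by move=> cf; case: (cf [::]) => // _; exact. Qed.

Lemma smooth_Cn n f : smooth f -> Cn n f.
Proof. by move=> /smoothP. Qed.

Lemma smooth_derivable f p u : smooth f -> derivable f u (delta_mx 0 p).
Proof. by move=> /(smooth_Cn (n:=0))/Cn_derivable. Qed.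

Lemma smooth_continuous f : smooth f -> continuous f.
Proof. by move=> /(smooth_Cn (n:=0))/Cn_continuous. Qed.

Lemma smooth_partial p f : smooth f -> smooth (partial p f).
Proof. by move=> sf s; rewrite -foldr_rcons; exact: sf. Qed.

Lemma partial_cst p c : partial p (fun=> c) = fun=> 0.
Proof. by apply/funext => u; exact: derive_cst. Qed.

Lemma smooth_cst c : smooth (fun=> c : R).
Proof.
apply/smoothP => n; elim: n c => [|n IH] c.
  by apply: Cn0 => [u|p u]; [exact: cst_continuous|exact: derivable_cst].
apply/CnS; split; last by move=> p; rewrite partial_cst.
by apply: Cn0 => [u|p u]; [exact: cst_continuous|exact: derivable_cst].
Qed.

Let is_derive_coord u v (j : 'I_3) :
  is_derive u v (fun w : 'rV[R]_3 => w 0 j) (v 0 j).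
Proof.
have E : \forall h \near 0^', (h : R)^-1 *:
    (((fun w : 'rV[R]_3 => w 0 j) \o shift u) (h *: v) - u 0 j) = v 0 j.
  near=> h; rewrite /= !mxE addrK [_ *: _]mulKf //.
  by near: h; exact: nbhs_dnbhs_neq.
have C : (fun h : R => h^-1 *:
    (((fun w : 'rV[R]_3 => w 0 j) \o shift u) (h *: v) - u 0 j)) @ 0^' -->
      v 0 j.
  exact: cvg_near_cst.
split; last exact: (cvg_lim _ C).
by apply/cvg_ex; exists (v 0 j).
Unshelve. all: by end_near. Qed.

Lemma partial_coord p j : partial p (fun w => w 0 j) = fun=> (j == p)%:R :> R.
Proof.
apply/funext => u;
  rewrite /partial (@derive_val _ _ _ _ _ _ _ (is_derive_coord u (delta_mx 0 p)
    j)).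
by rewrite !mxE eqxx.
Qed.

Lemma smooth_coord j : smooth (fun w => w 0 j : R).
Proof.
apply/smoothP; elim=> [|n IH].
  apply: Cn0 => [|p u]; first exact: coord_continuous.
  by have [] := is_derive_coord u (delta_mx 0 p) j.
apply/CnS; split; last by move=> p; rewrite partial_coord;
  exact/smooth_Cn/smooth_cst.
by move=> s; rewrite leqn0 => /nilP ->; exact: (IH [::]).
Qed.

Let partialD_Cn n p f g : Cn n f -> Cn n g ->
  partial p (fun w => f w + g w) = fun w => partial p f w + partial p g w.
Proof.
by move=> cf cg; apply/funext => u; apply: deriveD;
  [exact: Cn_derivable cf|exact: Cn_derivable cg].
Qed.

Let partialM_Cn n p f g : Cn n f -> Cn n g ->
  partial p (fun w => f w * g w)
  = fun w => partial p f w * g w + f w * partial p g w.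
Proof.
move=> cf cg; apply/funext => u.
rewrite /partial (@deriveM _ _ f g);
  [|exact: Cn_derivable cf|exact: Cn_derivable cg].
by rewrite addrC [X in X + _]mulrC.
Qed.

Let CnD n f g : Cn n f -> Cn n g -> Cn n (fun w => f w + g w).
Proof.
elim: n f g => [|n IH] f g cf cg.
  apply: Cn0 => [u|p u];
    first exact: (@continuousD _ _ _ f g u (@Cn_continuous _ _ cf u)
      (@Cn_continuous _ _ cg u)).
  by apply: derivableD; [exact: Cn_derivable cf|exact: Cn_derivable cg].
apply/CnS; split.
  apply: Cn0 => [u|p u];
    first exact: (@continuousD _ _ _ f g u (@Cn_continuous _ _ cf u)
      (@Cn_continuous _ _ cg u)).
  by apply: derivableD; [exact: Cn_derivable cf|exact: Cn_derivable cg].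
move=> p; rewrite (partialD_Cn p cf cg).
by apply: IH; [move/CnS: cf => []|move/CnS: cg => []].
Qed.

Let CnM n f g : Cn n f -> Cn n g -> Cn n (fun w => f w * g w).
Proof.
elim: n f g => [|n IH] f g cf cg.
  apply: Cn0 => [u|p u];
    first exact: (@continuousM _ _ f g u (@Cn_continuous _ _ cf u)
      (@Cn_continuous _ _ cg u)).
  by apply: derivableM; [exact: Cn_derivable cf|exact: Cn_derivable cg].
apply/CnS; split.
  apply: Cn0 => [u|p u];
    first exact: (@continuousM _ _ f g u (@Cn_continuous _ _ cf u)
      (@Cn_continuous _ _ cg u)).
  by apply: derivableM; [exact: Cn_derivable cf|exact: Cn_derivable cg].
move=> p; rewrite (partialM_Cn p cf cg).
have [_ cf'] := (CnS n f).1 cf; have [_ cg'] := (CnS n g).1 cg.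
by apply: CnD; apply: IH => //; exact: CnW.
Qed.

Lemma smoothD f g : smooth f -> smooth g -> smooth (fun w => f w + g w).
Proof. by move=> sf sg; apply/smoothP => n; apply: CnD; exact: smooth_Cn. Qed.

Lemma smoothM f g : smooth f -> smooth g -> smooth (fun w => f w * g w).
Proof. by move=> sf sg; apply/smoothP => n; apply: CnM; exact: smooth_Cn. Qed.

Lemma smoothN f : smooth f -> smooth (fun w => - f w).
Proof.
move=> sf; rewrite (_ : (fun w => - f w) = fun w => -1 * f w).
  exact: smoothM (smooth_cst _) sf.
by apply/funext => u; rewrite mulN1r.
Qed.

Lemma smooth_sum n (F : 'I_n -> 'rV[R]_3 -> R) :
  (forall i, smooth (F i)) -> smooth (fun w => \sum_i F i w).
Proof.
move=> sF; rewrite -[X in smooth X](_ : (\sum_i F i) = _); last first.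
  by apply/funext => u; rewrite fct_sumE.
by elim/big_ind: _ => [|g h|i _]; [exact: smooth_cst|exact: smoothD|exact: sF].
Qed.

Lemma partialD p f g : smooth f -> smooth g ->
  partial p (fun w => f w + g w) = fun w => partial p f w + partial p g w.
Proof. by move=> sf sg;
  exact: partialD_Cn (smooth_Cn (n:=0) sf) (smooth_Cn sg). Qed.

Lemma partialM p f g : smooth f -> smooth g ->
  partial p (fun w => f w * g w)
  = fun w => partial p f w * g w + f w * partial p g w.
Proof. by move=> sf sg;
  exact: partialM_Cn (smooth_Cn (n:=0) sf) (smooth_Cn sg). Qed.

Lemma partialN p f : smooth f ->
  partial p (fun w => - f w) = fun w => - partial p f w.
Proof.
by move=> sf; apply/funext => u; apply: deriveN; exact: smooth_derivable.
Qed.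

Lemma partial_sum n p (F : 'I_n -> 'rV[R]_3 -> R) :
  (forall i, smooth (F i)) ->
  partial p (fun w => \sum_i F i w) = fun w => \sum_i partial p (F i) w.
Proof.
move=> sF; apply/funext => u; rewrite /partial -derive_sum; last first.
  by move=> i; exact: smooth_derivable.
by congr ('D__ _ _); apply/funext => w; rewrite fct_sumE.
Qed.

Lemma partialC p q f : smooth f ->
  partial p (partial q f) = partial q (partial p f).
Proof.
move=> sf; apply/funext => u.
have d r x : derivable f x (delta_mx 0 r) by exact: smooth_derivable.
by apply: derive_comm => // [x|x||];
  do ?[exact/smooth_derivable/smooth_partial
      |exact/smooth_continuous/smooth_partial/smooth_partial].
Qed.

End SmoothFunctions.

(** * Operators of a general smooth a *)

Lemma sum_ord2 (W : nmodType) (F : 'I_2 -> W) : \sum_i F i = F 0 + F 1.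
Proof. by rewrite !big_ord_recl big_ord0 addr0; congr (_ + F _);
  apply/val_inj. Qed.

Lemma sum_ord3 (W : nmodType) (F : 'I_3 -> W) : \sum_i F i = F 0 + F 1 + F 2.
Proof.
rewrite !big_ord_recl big_ord0 addr0 addrA.
by congr (_ + F _ + F _); apply/val_inj.
Qed.

Lemma ord2P (P : 'I_2 -> Prop) : P 0 -> P 1 -> forall i, P i.
Proof.
move=> P0 P1 [[|[|//]] Hi].
  by rewrite (_ : Ordinal Hi = 0) //; exact/val_inj.
by rewrite (_ : Ordinal Hi = 1) //; exact/val_inj.
Qed.

Lemma ord3P (P : 'I_3 -> Prop) : P 0 -> P 1 -> P 2 -> forall i, P i.
Proof.
move=> P0 P1 P2 [[|[|[|//]]] Hi].
- by rewrite (_ : Ordinal Hi = 0) //; exact/val_inj.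
- by rewrite (_ : Ordinal Hi = 1) //; exact/val_inj.
- by rewrite (_ : Ordinal Hi = 2) //; exact/val_inj.
Qed.

Lemma sum_mxtens (W : nmodType) m n (F : 'I_(m * n) -> W) :
  \sum_c F c = \sum_i \sum_j F (mxtens_index (i, j)).
Proof.
rewrite pair_big /= (reindex (@mxtens_index m n)) /=.
  by apply: eq_bigr => -[].
by exists (@mxtens_unindex m n) => c _;
  [exact: mxtens_indexK|exact: mxtens_unindexK].
Qed.

Lemma gram_formE (R : realType) m n (M : 'M[R]_(m, n)) (v : 'cV[R]_n) :
  gram_form M v = \sum_i ((M *m v) i 0) ^+ 2.
Proof.
rewrite /gram_form -mulmxA -trmx_mul mxE.
by apply: eq_bigr => i _; rewrite mxE expr2.
Qed.

Section FirstOrderOperators.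
Set Implicit Arguments.
Unset Strict Implicit.
Context {R : realType}.
Variables (a : 'rV[R]_3 -> 'M[R]_(3, 2)) (z : 'rV[R]_3 -> 'cV[R]_3).
Implicit Types (f g V : 'rV[R]_3 -> R) (u : 'rV[R]_3).

Lemma AopE i f : Aop a i f = fun u => \sum_p alpha a i p u * partial p f u.
Proof.
by apply/funext => u; rewrite /Aop mxE; apply: eq_bigr => p _;
  rewrite [grad _ _ _ _]mxE.
Qed.

Lemma ZopE f : Zop z f = fun u => \sum_p zeta z p u * partial p f u.
Proof.
by apply/funext => u; rewrite /Zop mxE; apply: eq_bigr => p _;
  rewrite [grad _ _ _ _]mxE.
Qed.

Lemma smooth_Aop i f : (forall p, smooth (alpha a i p)) -> smooth f ->
  smooth (Aop a i f).
Proof.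
move=> sa sf; rewrite AopE; apply: smooth_sum => p.
by apply: smoothM; [exact: sa|exact: smooth_partial].
Qed.

End FirstOrderOperators.

(* ring and field compare atoms up to conversion, which unfolds these limits. *)
Ltac generalize_values :=
  repeat match goal with
  | |- context [partial ?p ?f ?u] => move: (partial p f u) => ?
  | |- context [Aop ?a ?p ?f ?u] => move: (Aop a p f u) => ?
  | |- context [Lop ?a ?V ?f ?u] => move: (Lop a V f u) => ?
  | |- context [Gamma1 ?a ?f ?g ?u] => move: (Gamma1 a f g u) => ?
  end.

(** Syntax-directed: descends through sums, products and operators to constants, coordinates and
    hypotheses, eta-contracting when the body is an application that no earlier rule matches. *)
Ltac prove_smooth :=
  lazymatch goal with
  | |- forall i, _ => let i := fresh in intro i; prove_smooth
  | |- smooth (fun _ => ?c) => exact: smooth_cst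
  | |- smooth (fun u => GRing.add (@?f u) (@?g u)) =>
      apply: (@smoothD _ f g); prove_smooth
  | |- smooth (fun u => GRing.mul (@?f u) (@?g u)) =>
      apply: (@smoothM _ f g); prove_smooth
  | |- smooth (fun u => GRing.opp (@?f u)) => apply: (@smoothN _ f);
    prove_smooth
  | |- smooth (fun u => fun_of_matrix u _ _) => exact: smooth_coord
  | |- smooth (fun u => bigop.body _ _ _) =>
      apply: smooth_sum; prove_smooth
  | |- smooth (fun u => ?f u) => change (smooth f); prove_smooth
  | |- smooth (partial _ _) => apply: smooth_partial; prove_smooth
  | |- smooth (Aop _ _ _) => apply: smooth_Aop; prove_smooth
  | H : forall i p, smooth (alpha ?a i p) |- smooth (alpha ?a _ _) => exact: H
  | H : smooth ?f |- smooth ?f => exact H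
  end.

Section GeneralOperators.
Set Implicit Arguments.
Unset Strict Implicit.
Context {R : realType}.
Variable a : 'rV[R]_3 -> 'M[R]_(3, 2).
Hypothesis smooth_alpha : forall i p, smooth (alpha a i p).
Implicit Types (f g V : 'rV[R]_3 -> R) (u : 'rV[R]_3).

Lemma AopD i f g : smooth f -> smooth g ->
  Aop a i (fun w => f w + g w) = fun w => Aop a i f w + Aop a i g w.
Proof.
move=> sf sg; apply/funext => u; rewrite !AopE -big_split /=.
by apply: eq_bigr => p _; rewrite partialD; try prove_smooth; rewrite mulrDr.
Qed.

Lemma AopN i f : smooth f ->
  Aop a i (fun w => - f w) = fun w => - Aop a i f w.
Proof.
move=> sf; apply/funext => u; rewrite !AopE -sumrN.
by apply: eq_bigr => p _; rewrite partialN; try prove_smooth; rewrite mulrN.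
Qed.

Lemma AopM i f g : smooth f -> smooth g ->
  Aop a i (fun w => f w * g w) = fun w => Aop a i f w * g w + f w * Aop a i g w.
Proof.
move=> sf sg; apply/funext => u;
  rewrite !AopE mulr_suml mulr_sumr -big_split /=.
by apply: eq_bigr => p _; rewrite partialM; try prove_smooth; ring.
Qed.

Lemma aaT_grad f u p : (aaT a u *m grad f u) p 0
  = \sum_k alpha a k p u * Aop a k f u.
Proof.
rewrite /aaT -mulmxA mxE; apply: eq_bigr => k _.
by rewrite /alpha [_^T _ _]mxE.
Qed.

Lemma bvecE V r : (fun u => bvec a V u r 0)
  = fun u => - 2^-1 * \sum_k alpha a k r u * Aop a k V u.
Proof. by apply/funext => u; rewrite /bvec mxE aaT_grad. Qed.

Lemma Gamma1E f g : Gamma1 a f g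
  = fun u => Aop a 0 f u * Aop a 0 g u + Aop a 1 f u * Aop a 1 g u.
Proof. by apply/funext => u; rewrite /Gamma1 sum_ord2. Qed.

(* The two first-order terms with coefficients div (a e_k) cancel.            *)
Lemma LopE V f : smooth f ->
  Lop a V f = fun u => Aop a 0 (Aop a 0 f) u + Aop a 1 (Aop a 1 f) u
    + - (Aop a 0 V u * Aop a 0 f u + Aop a 1 V u * Aop a 1 f u).
Proof.
move=> sf; apply/funext => u; rewrite /Lop.
have -> : div (fun w => aaT a w *m grad f w) u
  = \sum_k ((\sum_p partial p (alpha a k p) u) * Aop a k f u
       + Aop a k (Aop a k f) u).
  rewrite /div (eq_bigr (fun p => \sum_k (partial p (alpha a k p) u
    * Aop a k f u
     + alpha a k p u * partial p (Aop a k f) u))) => [|p _].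
    rewrite exchange_big /=; apply: eq_bigr => k _.
    by rewrite big_split /= mulr_suml [in X in _ = _ + X]AopE.
  under [X in partial p X]funext => w do rewrite aaT_grad.
  rewrite partial_sum; try prove_smooth.
  by apply: eq_bigr => k _; rewrite partialM; [|prove_smooth..].
have -> : dot (a_tensor_grad_a a u) (grad f u)
    = \sum_k (\sum_q partial q (alpha a k q) u) * Aop a k f u.
  rewrite /dot mxE (eq_bigr (fun p => \sum_k (\sum_q partial q (alpha a k q) u)
     * (alpha a k p u * partial p f u))) => [|p _].
    rewrite exchange_big /=; apply: eq_bigr => k _.
    by rewrite -mulr_sumr [in RHS]AopE.
  rewrite !mxE mulr_suml; apply: eq_bigr => k _.
  by rewrite -mulr_sumr; ring.
have -> : dot (grad V u) (aaT a u *m grad f u)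
    = \sum_k Aop a k V u * Aop a k f u.
  rewrite /dot mxE (eq_bigr (fun p => \sum_k alpha a k p u * partial p V u
     * Aop a k f u)) => [|p _].
    rewrite exchange_big /=; apply: eq_bigr => k _.
    by rewrite -mulr_suml [in RHS]AopE.
  rewrite aaT_grad !mxE mulr_sumr; apply: eq_bigr => k _; ring.
by rewrite big_split /= [X in X - _ - _]addrC addrK !sum_ord2.
Qed.

Lemma LopD V f g : smooth f -> smooth g ->
  Lop a V (fun w => f w + g w) = fun w => Lop a V f w + Lop a V g w.
Proof.
move=> sf sg; apply/funext => u; rewrite !LopE; try prove_smooth.
do !(rewrite !AopD; try prove_smooth); generalize_values; ring.
Qed.

(** Diffusion property: L has no zeroth-order term and the A_k are derivations, so Gamma_1 is the
    carré du champ of L. *)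
Lemma Lop_sqr V f : smooth f -> Lop a V (fun w => f w * f w)
  = fun w => 2 * (f w * Lop a V f w + Gamma1 a f f w).
Proof.
move=> sf; apply/funext => u; rewrite Gamma1E !LopE; try prove_smooth.
do !(rewrite !AopM; try prove_smooth); do !(rewrite !AopD; try prove_smooth).
do !(rewrite !AopM; try prove_smooth); generalize_values; ring.
Qed.

(** Gamma_1(f,f) is a sum of squares of the A_k f, so [Lop_sqr] applies to each; subtracting
    Gamma_1(L f, f) leaves the commutators of L with A_k. *)
Lemma Gamma2E V f u : smooth f -> Gamma2 a V f u
  = \sum_k (Gamma1 a (Aop a k f) (Aop a k f) u
       + Aop a k f u * (Lop a V (Aop a k f) u - Aop a k (Lop a V f) u)).
Proof.
move=> sf;
  rewrite /Gamma2 [Gamma1 a f f]Gamma1E [Gamma1 a (Lop a V f) f]Gamma1E.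
rewrite LopD; try prove_smooth; rewrite !Lop_sqr; try prove_smooth.
rewrite sum_ord2; by generalize_values; field.
Qed.

(** * Compositions and brackets of the fields A_i, and their brackets with the drift *)

Lemma Aop_cst i (c : R) : Aop a i (fun=> c) = fun=> 0.
Proof.
apply/funext => u; rewrite AopE; apply: big1 => p _.
by rewrite partial_cst mulr0.
Qed.

Lemma Aop_sum n i (F : 'I_n -> 'rV[R]_3 -> R) : (forall k, smooth (F k)) ->
  Aop a i (fun w => \sum_k F k w) = fun w => \sum_k Aop a i (F k) w.
Proof.
move=> sF; apply/funext => u; under [RHS]eq_bigr => k _ do rewrite AopE.
rewrite AopE exchange_big /=; apply: eq_bigr => p _.
by rewrite partial_sum // mulr_sumr.
Qed.

(** Leibniz rule: the first sum, where A_i hits the coefficients of A_k, is D_ik, and the second is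
    the entry (i, k) of Q X. *)
Lemma Aop_Aop i k f u : smooth f -> Aop a i (Aop a k f) u
  = \sum_r Aop a i (alpha a k r) u * partial r f u
    + \sum_p \sum_q alpha a i p u * alpha a k q u * partial p (partial q f) u.
Proof.
move=> sf; rewrite [Aop a k f]AopE Aop_sum; try prove_smooth.
under eq_bigr => r _ do (rewrite AopM; try prove_smooth).
rewrite big_split /=; congr (_ + _).
rewrite exchange_big /=; apply: eq_bigr => q _.
rewrite AopE mulr_sumr; apply: eq_bigr => p _.
by rewrite mulrA [alpha a k q u * _]mulrC.
Qed.

(** The second-order parts cancel by symmetry of second derivatives, so the bracket is again a
    vector field. *)
Lemma Aop_bracket i k f u : smooth f ->
  Aop a i (Aop a k f) u - Aop a k (Aop a i f) u
  = \sum_r (Aop a i (alpha a k r) u - Aop a k (alpha a i r) u) * partial r f u.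
Proof.
move=> sf; rewrite !Aop_Aop //.
have -> : \sum_p \sum_q alpha a k p u * alpha a i q u
  * partial p (partial q f) u
  = \sum_p \sum_q alpha a i p u * alpha a k q u * partial p (partial q f) u.
  rewrite exchange_big /=; apply: eq_bigr => p _; apply: eq_bigr => q _.
  by rewrite (partialC q p sf) [alpha a k q u * _]mulrC.
rewrite opprD addrACA subrr addr0 -sumrB.
by apply: eq_bigr => r _; rewrite mulrBl.
Qed.

(** The left side is the Lie bracket [A_i, b] applied to f. As b = -1/2 sum_k (A_k V) a e_k, the
    Leibniz rule splits it into A_i acting on A_k V and the bracket [A_i, A_k]. *)
Lemma drift_bracket V f i u : smooth V -> smooth f ->
  \sum_q \sum_r (alpha a i q u * partial q (fun w => bvec a V w r 0) u
    * partial r f u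
      - bvec a V u r 0 * partial r (alpha a i q) u * partial q f u)
  = - 2^-1 * \sum_k (Aop a i (Aop a k V) u * Aop a k f u
      + Aop a k V u * (Aop a i (Aop a k f) u - Aop a k (Aop a i f) u)).
Proof.
move=> sV sf.
have b1 r : \sum_q alpha a i q u * partial q (fun w => bvec a V w r 0) u
    = - 2^-1 * \sum_k (Aop a i (alpha a k r) u * Aop a k V u
        + alpha a k r u * Aop a i (Aop a k V) u).
  rewrite bvecE -[LHS](congr1 (@^~ u) (AopE a i _)).
  rewrite AopM; try prove_smooth; rewrite Aop_cst mul0r add0r Aop_sum;
    try prove_smooth.
  congr (_ * _); apply: eq_bigr => k _.
  by rewrite AopM; try prove_smooth.
have b2 q : \sum_r bvec a V u r 0 * partial r (alpha a i q) u
    = - 2^-1 * \sum_k Aop a k V u * Aop a k (alpha a i q) u.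
  have bE r : bvec a V u r 0 = - 2^-1 * \sum_k alpha a k r u * Aop a k V u.
    by rewrite /bvec mxE aaT_grad.
  under eq_bigr => r _ do rewrite bE -mulrA mulr_suml.
  rewrite -mulr_sumr exchange_big /=; congr (_ * _); apply: eq_bigr => k _.
  rewrite [Aop a k (alpha a i q)]AopE mulr_sumr; apply: eq_bigr => r _.
  by rewrite mulrAC mulrC.
under eq_bigr => q _ do rewrite sumrB -[X in _ - X]mulr_suml b2.
rewrite sumrB exchange_big /=.
under eq_bigr => r _ do rewrite -mulr_suml b1.
rewrite -sumrB.
rewrite (eq_bigr (fun r => - 2^-1 * \sum_k
    ((Aop a i (alpha a k r) u * Aop a k V u
      + alpha a k r u * Aop a i (Aop a k V) u) * partial r f u
     - Aop a k V u * Aop a k (alpha a i r) u * partial r f u))) => [|r _].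
  2: by rewrite sumrB -!mulr_suml mulrBr !mulrA.
rewrite -mulr_sumr; congr (_ * _).
rewrite exchange_big /=; apply: eq_bigr => k _.
rewrite Aop_bracket // [Aop a k f]AopE !mulr_sumr -big_split /=.
apply: eq_bigr => r _; generalize_values; ring.
Qed.

Lemma R_ab_drift V f u : smooth V -> smooth f ->
  2 * \sum_i (\sum_q \sum_r
     (alpha a i q u * partial q (fun w => bvec a V w r 0) u * partial r f u
      - bvec a V u r 0 * partial r (alpha a i q) u * partial q f u))
        * Aop a i f u
  = - \sum_i \sum_k (Aop a i (Aop a k V) u * Aop a k f u
      + Aop a k V u * (Aop a i (Aop a k f) u - Aop a k (Aop a i f) u))
        * Aop a i f u.
Proof.
move=> sV sf; rewrite mulr_sumr -sumrN; apply: eq_bigr => i _.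
rewrite drift_bracket // -mulr_suml; set S := \sum_k _.
by move: S (Aop _ _ _ _) => S w; field.
Qed.

Lemma Qmx_Dvec f u c : smooth f ->
  (Qmx a u *m Xvec f u) c 0 + Dvec a f u c 0
  = Aop a (mxtens_unindex c).1 (Aop a (mxtens_unindex c).2 f) u.
Proof.
move=> sf; rewrite Aop_Aop // addrC; congr (_ + _).
  rewrite mxE exchange_big /=; apply: eq_bigr => r _.
  by rewrite AopE mulr_suml.
rewrite mxE sum_mxtens; apply: eq_bigr => p _; apply: eq_bigr => q _.
by rewrite !mxE mxtens_indexK.
Qed.

End GeneralOperators.

(** * The Heisenberg group *)

Section Heisenberg.
Set Implicit Arguments.
Unset Strict Implicit.
Context {R : realType}.
Implicit Types (f g V rho : 'rV[R]_3 -> R) (u : 'rV[R]_3).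
Local Notation a := (@heis_a R).
Local Notation z := (@heis_z R).

(** * Coefficients of the Heisenberg frame and their derivatives *)

Lemma alpha_heis : ((alpha a 0 0 = fun=> 1) * (alpha a 0 1 = fun=> 0)
  * (alpha a 0 2 = fun u => - (u 0 1 / 2))
  * (alpha a 1 0 = fun=> 0) * (alpha a 1 1 = fun=> 1)
  * (alpha a 1 2 = fun u => u 0 0 / 2))%type.
Proof.
by do !split; apply/funext => u; rewrite /alpha /heis_a trmxK /heis_aT mxE.
Qed.

Lemma zeta_heis : ((zeta z 0 = fun=> 0) * (zeta z 1 = fun=> 0)
  * (zeta z 2 = fun=> 1))%type.
Proof.
by do !split; apply/funext => u; rewrite /zeta /heis_z trmxK /heis_zT mxE.
Qed.

Lemma smooth_alpha_heis i p : smooth (alpha a i p).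
Proof. by elim/ord2P: i; elim/ord3P: p; rewrite alpha_heis; prove_smooth. Qed.

Let sa := smooth_alpha_heis.

Lemma partial_zeta_heis p q : partial p (zeta z q) = fun=> 0.
Proof. by elim/ord3P: q; rewrite zeta_heis partial_cst. Qed.

(* The only nonconstant entries of a sit in the row q = 2 and depend on the   *)
(* coordinates 0 and 1 alone.                                                 *)
Lemma partial_alpha_heis p i q :
  exists2 c : R, partial p (alpha a i q) = (fun=> c) & (p == 2) || (q != 2) ->
    c = 0.
Proof.
elim/ord2P: i; elim/ord3P: q; rewrite alpha_heis ?partial_cst; try by exists 0.
  rewrite partialN; try prove_smooth; rewrite partialM; try prove_smooth;
    rewrite partial_coord partial_cst.
  exists (- ((1 == p)%:R / 2)); first by apply/funext => u; ring.
  by rewrite orbF => /eqP ->; rewrite mul0r oppr0.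
rewrite partialM; try prove_smooth; rewrite partial_coord partial_cst.
exists ((0 == p)%:R / 2); first by apply/funext => u; ring.
by rewrite orbF => /eqP ->; rewrite mul0r.
Qed.

Lemma partial_alpha_heis2 i q : partial 2 (alpha a i q) = fun=> 0.
Proof. by have [c -> ->] := partial_alpha_heis 2 i q. Qed.

Lemma partial2_alpha_heis p q i r : partial p (partial q (alpha a i r))
  = fun=> 0.
Proof. by have [c -> _] := partial_alpha_heis q i r; rewrite partial_cst. Qed.

(** The first derivative vanishes unless q = 2, the second one vanishes if q = 2: a reflection of
    the step-two nilpotency. *)
Lemma mul_partial_alpha_heis (b : R) p i q k r u :
  b * partial p (alpha a i q) u * partial q (alpha a k r) u = 0.
Proof.
have [c -> ce] := partial_alpha_heis p i q.
have [d -> de] := partial_alpha_heis q k r.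
have [q2|q2] := eqVneq q 2; first by rewrite de ?mulr0 // q2 eqxx.
by rewrite ce ?mulr0 ?mul0r // q2 orbT.
Qed.

Lemma mul_zeta_partial_alpha_heis q i r u :
  zeta z q u * partial q (alpha a i r) u = 0.
Proof.
elim/ord3P: q; rewrite zeta_heis ?mul0r //.
by rewrite partial_alpha_heis2 mulr0.
Qed.

(** * The fields in coordinates and their commutation relations *)

Lemma Aop_heis0 f :
  Aop a 0 f = fun u => partial 0 f u + - (u 0 1 / 2) * partial 2 f u.
Proof.
by apply/funext => u; rewrite AopE sum_ord3 !alpha_heis mul1r mul0r addr0.
Qed.

Lemma Aop_heis1 f :
  Aop a 1 f = fun u => partial 1 f u + u 0 0 / 2 * partial 2 f u.
Proof.
by apply/funext => u; rewrite AopE sum_ord3 !alpha_heis mul1r mul0r add0r.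
Qed.

Lemma Zop_heis f : Zop z f = partial 2 f.
Proof.
by apply/funext => u; rewrite ZopE sum_ord3 !zeta_heis mul1r !mul0r !add0r.
Qed.

Lemma partial_Aop_heis0 p f : smooth f -> partial p (Aop a 0 f)
  = fun u => Aop a 0 (partial p f) u - (p == 1)%:R / 2 * partial 2 f u.
Proof.
move=> sf; apply/funext => u; rewrite !Aop_heis0 partialD; try prove_smooth;
  rewrite partialM; try prove_smooth.
rewrite partialN; try prove_smooth; rewrite partialM; try prove_smooth;
  rewrite partial_coord partial_cst.
rewrite (partialC p 0 sf) (partialC p 2 sf) [1 == p]eq_sym.
generalize_values; ring.
Qed.

Lemma partial_Aop_heis1 p f : smooth f -> partial p (Aop a 1 f)
  = fun u => Aop a 1 (partial p f) u + (p == 0)%:R / 2 * partial 2 f u.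
Proof.
move=> sf; apply/funext => u; rewrite !Aop_heis1 partialD; try prove_smooth;
  rewrite partialM; try prove_smooth.
rewrite partialM; try prove_smooth; rewrite partial_coord partial_cst.
rewrite (partialC p 1 sf) (partialC p 2 sf) [0 == p]eq_sym.
generalize_values; ring.
Qed.

(** The relation [A_0, A_1] = Z, oriented to move A_0 to the left of A_1, which gives iterated
    derivatives a normal form. *)
Lemma Aop_heisC f : smooth f ->
  Aop a 1 (Aop a 0 f) = fun u => Aop a 0 (Aop a 1 f) u - partial 2 f u.
Proof.
move=> sf; apply/funext => u;
  rewrite [Aop a 1 (Aop a 0 f)]Aop_heis1 [Aop a 0 (Aop a 1 f)]Aop_heis0.
rewrite !(partial_Aop_heis0 _ sf) !(partial_Aop_heis1 _ sf) !Aop_heis0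
  !Aop_heis1.
rewrite (partialC 1 0 sf) (partialC 2 0 sf) (partialC 2 1 sf) !eqxx /=.
by generalize_values; field.
Qed.

Lemma Zop_Aop_heis i f : smooth f -> partial 2 (Aop a i f)
  = Aop a i (partial 2 f).
Proof.
move=> sf; elim/ord2P: i; apply/funext => u;
  rewrite ?(partial_Aop_heis0 _ sf) ?(partial_Aop_heis1 _ sf) /=;
    generalize_values; ring.
Qed.

(** * The two Gamma forms in the frame A_0, A_1, Z *)

Lemma Gamma2_heis V f u : smooth V -> smooth f -> Gamma2 a V f u
  = \sum_i \sum_k (Aop a i (Aop a k f) u ^+ 2
       + Aop a k (Aop a i V) u * Aop a i f u * Aop a k f u)
    + 2 * (Aop a 0 (partial 2 f) u * Aop a 1 f u
           - Aop a 1 (partial 2 f) u * Aop a 0 f u)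
    + partial 2 f u * (Aop a 1 V u * Aop a 0 f u - Aop a 0 V u * Aop a 1 f u).
Proof.
move=> sV sf; rewrite Gamma2E //.
(* Normal ordering of the third-order words: A_0 crosses A_1 twice, each time producing the central
   Z, hence the factor 2 of the cross terms. *)
have E1 : Aop a 1 (Aop a 1 (Aop a 0 f)) u
    = Aop a 0 (Aop a 1 (Aop a 1 f)) u - 2 * Aop a 1 (partial 2 f) u.
  rewrite Aop_heisC //; rewrite AopD; try prove_smooth; rewrite AopN;
    try prove_smooth.
  rewrite Aop_heisC; try prove_smooth; rewrite Zop_Aop_heis; try prove_smooth.
  generalize_values; ring.
have E2 : Aop a 1 (Aop a 0 (Aop a 0 f)) u
    = Aop a 0 (Aop a 0 (Aop a 1 f)) u - 2 * Aop a 0 (partial 2 f) u.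
  rewrite Aop_heisC; try prove_smooth; rewrite Aop_heisC; try prove_smooth.
  rewrite AopD; try prove_smooth; rewrite AopN; try prove_smooth.
  rewrite Zop_Aop_heis; try prove_smooth.
  generalize_values; ring.
have E0 : Aop a 1 (Aop a 0 f) u = Aop a 0 (Aop a 1 f) u - partial 2 f u.
  by rewrite Aop_heisC.
rewrite !sum_ord2 !Gamma1E !LopE; try prove_smooth.
do !(rewrite !AopD; try prove_smooth); do !(rewrite !AopN; try prove_smooth).
do !(rewrite !AopD; try prove_smooth); do !(rewrite !AopM; try prove_smooth).
rewrite E1 E2 !E0; generalize_values; ring.
Qed.

(** Z commutes with both A_i, so only the coefficients A_i V of the drift contribute to [Z, L]. *)
Lemma Zop_Lop_heis V f u : smooth V -> smooth f ->
  partial 2 (Lop a V f) u = Lop a V (partial 2 f) u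
    - \sum_i Aop a i (partial 2 V) u * Aop a i f u.
Proof.
move=> sV sf; rewrite !LopE; try prove_smooth.
do !(rewrite !partialD; try prove_smooth); do !(rewrite !partialN;
  try prove_smooth).
do !(rewrite !partialD; try prove_smooth); do !(rewrite !partialM;
  try prove_smooth).
do !(rewrite !Zop_Aop_heis; try prove_smooth).
rewrite sum_ord2; generalize_values; ring.
Qed.

Lemma div_zzT_heis rho f u :
  div (fun w => rho w *: (zzT z w *m grad_quad f (aaT a) w)) u = 0.
Proof.
have D r s : partial 2 (fun w => aaT a w r s) = fun=> 0.
  have -> : (fun w => aaT a w r s)
      = fun w => \sum_k alpha a k r w * alpha a k s w.
    by apply/funext => w; rewrite mxE; apply: eq_bigr => k _;
      rewrite /alpha [_^T k r]mxE.
  rewrite partial_sum; try prove_smooth.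
  apply/funext => w; apply: big1 => k _; rewrite partialM; try prove_smooth.
  by rewrite !partial_alpha_heis2 mulr0 mul0r addr0.
(* z^T selects the component of index 2, which is built from the vanishing derivative [partial 2] of
   a a^T. *)
have G w : (z w)^T *m grad_quad f (aaT a) w = 0.
  apply/matrixP => i j; rewrite [LHS]mxE [RHS]mxE !ord1 sum_ord3.
  rewrite -/(zeta z 0 w) -/(zeta z 1 w) -/(zeta z 2 w) !zeta_heis !mul0r !add0r
    mul1r.
  rewrite mxE (_ : partial_mx 2 _ _ = 0) ?mul0mx /dot ?mulmx0 ?mxE //.
  by apply/matrixP => r s; rewrite [LHS]mxE [RHS]mxE D.
apply: big1 => p _; rewrite (_ : (fun w => _) = fun=> 0) ?partial_cst //.
by apply/funext => w; rewrite /zzT -mulmxA G mulmx0 scaler0 mxE.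
Qed.

Lemma div_aaT_heis rho f u :
  div (fun w => rho w *: (aaT a w *m grad_quad f (zzT z) w)) u = 0.
Proof.
have G w : grad_quad f (zzT z) w = 0.
  apply/matrixP => p j; rewrite [LHS]mxE [RHS]mxE.
  rewrite (_ : partial_mx p _ _ = 0) ?mul0mx /dot ?mulmx0 ?mxE //.
  apply/matrixP => r s; rewrite [LHS]mxE [RHS]mxE.
  rewrite (_ : (fun w => zzT z w r s) = fun=> zzT z 0 r s) ?partial_cst //.
apply: big1 => p _; rewrite (_ : (fun w => _) = fun=> 0) ?partial_cst //.
by apply/funext => w; rewrite G mulmx0 scaler0 mxE.
Qed.

Lemma Gamma2z_heis V rho f u : smooth V -> smooth f -> Gamma2z_rho a z V rho f u
  = \sum_i (Aop a i (partial 2 f) u ^+ 2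
       + Aop a i (partial 2 V) u * Aop a i f u * partial 2 f u).
Proof.
move=> sV sf; rewrite /Gamma2z_rho div_zzT_heis div_aaT_heis !mulr0 subr0 addr0.
have -> : Gamma1z z f f = fun w => partial 2 f w * partial 2 f w.
  by apply/funext => w; rewrite /Gamma1z Zop_heis.
rewrite /Gamma1z !Zop_heis Lop_sqr; try prove_smooth.
rewrite (Zop_Lop_heis _ sV sf) Gamma1E !sum_ord2; by generalize_values; field.
Qed.

(** * The tensors R_rho, R_zb and R_ab *)

Lemma R_rho_heis rho f u : R_rho a z rho f u = 0.
Proof.
(* The four blocks vanish separately: every summand has a derivative of zeta, a second derivative of
   alpha, or the null product zeta_q d_q alpha_ir. *)
have E (b c d e : R) : b = 0 -> c = 0 -> d = 0 -> e = 0 ->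
  2 * b + 2 * c - 2 * d - 2 * e = 0.
  by move=> -> -> -> ->; rewrite mulr0 !subr0 addr0.
apply: E.
- apply: big1 => i _; apply: big1 => p _; apply: big1 => q _;
  apply: big1 => r _.
  apply: big1 => s _; rewrite !partial_zeta_heis partial2_alpha_heis.
  rewrite !(mulr0, mul0r, add0r).
  rewrite -(mulrA _ (zeta z q u) (partial q _ u)) mul_zeta_partial_alpha_heis.
  by rewrite !(mulr0, mul0r).
- apply: big1 => i _; apply: big1 => q _; apply: big1 => r _;
  apply: big1 => s _.
  rewrite -(mulrA _ (zeta z q u) (partial q _ u)) mul_zeta_partial_alpha_heis.
  by rewrite !(mulr0, mul0r).
- apply: big1 => i _; apply: big1 => p _; apply: big1 => q _;
  apply: big1 => r _.
  apply: big1 => s _; rewrite !partial_zeta_heis partial_cst.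
  by rewrite !(mulr0, mul0r, addr0).
- apply: big1 => i _; apply: big1 => q _; apply: big1 => r _;
  apply: big1 => s _.
  by rewrite !partial_zeta_heis !(mulr0, mul0r, addr0).
Qed.

Lemma sum_zeta_heis (F : 'I_3 -> R) u : \sum_q zeta z q u * F q = F 2.
Proof. by rewrite sum_ord3 !zeta_heis !mul0r !add0r mul1r. Qed.

Lemma R_zb_heis V f u : smooth V -> R_zb a z V f u
  = \sum_i Aop a i (partial 2 V) u * Aop a i f u * partial 2 f u.
Proof.
move=> sV; rewrite /R_zb [X in X - _]big1 => [|i _]; last first.
  rewrite big1 ?mul0r // => p _; apply: big1 => q _; apply: big1 => r _.
  rewrite !partial_zeta_heis partial_cst partial2_alpha_heis.
  by rewrite mul_zeta_partial_alpha_heis !(mulr0, mul0r, subr0, addr0).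
(* Since zeta is constant, the bracket [Z, b] reduces to the derivative of b along the third
   coordinate, which falls on V alone. *)
have b r : partial 2 (fun w => bvec a V w r 0) u
    = - 2^-1 * \sum_k alpha a k r u * Aop a k (partial 2 V) u.
  rewrite bvecE partialM; try prove_smooth; rewrite partial_cst mul0r add0r.
  rewrite partial_sum; try prove_smooth; congr (_ * _); apply: eq_bigr => k _.
  rewrite partialM; try prove_smooth; rewrite partial_alpha_heis2 mul0r add0r.
  by rewrite Zop_Aop_heis.
rewrite (_ : \sum_q _ = - 2^-1 * \sum_k Aop a k (partial 2 V) u * Aop a k f u).
  rewrite Zop_heis sub0r -mulr_suml; move: (\sum_i _) (partial 2 f u) => S w.
  by field.
rewrite (eq_bigr (fun q => zeta z q u *
    \sum_r partial q (fun w => bvec a V w r 0) u * partial r f u)) => [|q _].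
  rewrite sum_zeta_heis.
  under eq_bigr => r _ do rewrite b -mulrA mulr_suml.
  rewrite -mulr_sumr exchange_big /=; congr (_ * _); apply: eq_bigr => k _.
  rewrite [Aop a k f]AopE mulr_sumr; apply: eq_bigr => r _.
  by rewrite mulrCA mulrA.
rewrite mulr_sumr; apply: eq_bigr => r _.
by rewrite partial_zeta_heis mulr0 mul0r subr0 mulrA.
Qed.

(** All purely geometric terms vanish, the coefficients of a being affine and chained derivatives
    being null; the drift brackets remain. *)
Lemma R_ab_heis V f u : smooth V -> smooth f -> R_ab a V f u
  = \sum_i \sum_k (Aop a i (Aop a k V) u * Aop a k f u
      + Aop a k V u * (Aop a i (Aop a k f) u - Aop a k (Aop a i f) u))
        * Aop a i f u.
Proof.
move=> sV sf; rewrite /R_ab R_ab_drift // opprK big1 ?add0r // => i _.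
apply: big1 => k _; rewrite big1 ?mul0r // => p _.
apply: big1 => q _; apply: big1 => r _; rewrite !partial2_alpha_heis.
rewrite !mul_partial_alpha_heis.
by rewrite !(mulr0, mul0r, subr0, addr0).
Qed.

(** * The vectors D and E, and the completed squares *)

Lemma Dvec_heis f u i k : Dvec a f u (mxtens_index (i, k)) 0
  = ((k == 1) && (i == 0))%:R / 2 * partial 2 f u
    - ((k == 0) && (i == 1))%:R / 2 * partial 2 f u.
Proof.
rewrite mxE mxtens_indexK /= exchange_big /=.
rewrite (eq_bigr (fun r => Aop a i (alpha a k r) u * partial r f u)) => [|r _].
  (* Only r = 2 contributes, through A_0 (x/2) = 1/2 and A_1 (-y/2) = -1/2. *)
  rewrite sum_ord3; elim/ord2P: k; rewrite !alpha_heis; elim/ord2P: i;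
  rewrite !(Aop_heis0, Aop_heis1) !partial_cst.
  - rewrite !partialN; try prove_smooth; rewrite !partialM; try prove_smooth.
    rewrite !partial_coord !partial_cst /=; by generalize_values; field.
  - rewrite !partialN; try prove_smooth; rewrite !partialM; try prove_smooth.
    rewrite !partial_coord !partial_cst /=; by generalize_values; field.
  - rewrite !partialM; try prove_smooth.
    rewrite !partial_coord !partial_cst /=; by generalize_values; field.
  - rewrite !partialM; try prove_smooth.
    rewrite !partial_coord !partial_cst /=; by generalize_values; field.
by rewrite AopE mulr_suml.
Qed.

Lemma Evec_heis f u : Evec a z f u = 0.
Proof.
apply/matrixP => i j; rewrite mxE [RHS]mxE; apply: big1 => p _.
by apply: big1 => r _; rewrite partial_zeta_heis mulr0 mul0r.
Qed.

Lemma heis_Lambda1_eq0 : heis_Lambda1 = 0 :> 'cV[R]_(3 * 3).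
Proof.
by apply/matrixP => i j; rewrite !mxE; case: i; do 9?[case=> //].
Qed.

Lemma Pmx_Xvec_heis f u k : smooth f ->
  (Pmx a z u *m Xvec f u) k 0 = Aop a k (partial 2 f) u.
Proof.
move=> sf; rewrite mxE sum_mxtens AopE sum_ord3.
rewrite big1 => [|q _]; last by rewrite !mxE mxtens_indexK zeta_heis !mul0r.
rewrite big1 => [|q _]; last by rewrite !mxE mxtens_indexK zeta_heis !mul0r.
rewrite !add0r; apply: eq_bigr => q _.
by rewrite !mxE mxtens_indexK zeta_heis mul1r (partialC _ 2 sf).
Qed.

(** The nonzero entries of Lambda_2 sit at the pairs (2, 0) and (2, 1), where P is the identity;
    they are chosen so that P Lambda_2 = (A_1 f, -A_0 f) completes the cross terms of
    [Gamma2_heis]. *)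
Lemma Pmx_Lambda2_heis f u k : (Pmx a z u *m heis_Lambda2 f u) k 0
  = (k == 0)%:R * Aop a 1 f u - (k == 1)%:R * Aop a 0 f u.
Proof.
rewrite mxE sum_mxtens sum_ord3.
rewrite big1 => [|q _]; last by rewrite !mxE mxtens_indexK zeta_heis !mul0r.
rewrite big1 => [|q _]; last by rewrite !mxE mxtens_indexK zeta_heis !mul0r.
rewrite sum_ord3 !mxE !mxtens_indexK /=.
rewrite !zeta_heis; elim/ord2P: k; rewrite !alpha_heis /=; generalize_values;
  ring.
Qed.

Lemma hess_sq_heis f u : smooth f ->
  hess_sq a z heis_Lambda1 (heis_Lambda2 f u) f u
  = (Aop a 0 (Aop a 0 f) u) ^+ 2
    + (Aop a 0 (Aop a 1 f) u - 2^-1 * partial 2 f u) ^+ 2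
    + (Aop a 1 (Aop a 0 f) u + 2^-1 * partial 2 f u) ^+ 2
    + (Aop a 1 (Aop a 1 f) u) ^+ 2
    + (Aop a 0 (partial 2 f) u + Aop a 1 f u) ^+ 2
    + (Aop a 1 (partial 2 f) u - Aop a 0 f u) ^+ 2.
Proof.
move=> sf; have Q i k : (Qmx a u *m Xvec f u) (mxtens_index (i, k)) 0
    = Aop a i (Aop a k f) u - Dvec a f u (mxtens_index (i, k)) 0.
  have := @Qmx_Dvec R a sa f u (mxtens_index (i, k)) sf.
  by rewrite mxtens_indexK => <-; rewrite addrK.
rewrite /hess_sq !gram_formE heis_Lambda1_eq0 addr0 sum_mxtens !sum_ord2.
rewrite !Q !Dvec_heis !mulmxDr ![(_ + _ : 'cV_2) _ _]mxE.
rewrite !Pmx_Xvec_heis // !Pmx_Lambda2_heis /=.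
by generalize_values; field.
Qed.

(** The last two terms are -|P Lambda_2|^2 and |D|^2; Lambda_1 and E vanish. *)
Lemma RG_ab_heis V f u : smooth V -> smooth f ->
  RG_ab a z V heis_Lambda1 (heis_Lambda2 f u) f u
  = \sum_i \sum_k (Aop a i (Aop a k V) u * Aop a k f u
      + Aop a k V u * (Aop a i (Aop a k f) u - Aop a k (Aop a i f) u))
        * Aop a i f u
    - (Aop a 0 f u ^+ 2 + Aop a 1 f u ^+ 2) + 2^-1 * partial 2 f u ^+ 2.
Proof.
move=> sV sf; rewrite /RG_ab R_ab_heis // heis_Lambda1_eq0 !gram_formE mulmx0.
rewrite [X in _ - X - _]big1 => [|c _]; last by rewrite mxE expr0n.
rewrite Evec_heis [dot 0 0]mxE [X in _ + X = _]big1 => [|c _];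
  last by rewrite !mxE mulr0.
rewrite [dot _ _]mxE sum_mxtens !sum_ord2 ![_^T _ _]mxE !Dvec_heis
  !Pmx_Lambda2_heis /=.
by generalize_values; field.
Qed.

End Heisenberg.

(** * Matching both sides as polynomials in derivative values *)

Theorem proposition4p1 (R : realType) (V : 'rV[R]_3 -> R)
    (smoothV : smooth V) (massV : (gibbs_mass V < +oo)%E)
    (f : 'rV[R]_3 -> R) (smoothf : smooth f) (u : 'rV[R]_3) :
  let a := @heis_a R in
  let z := @heis_z R in
  let rho := gibbs V in
  let L1 := @heis_Lambda1 R in
  let L2 := heis_Lambda2 f u in
  let x := u 0 0 in
  let y := u 0 1 in
  let A1 := fun g => Aop a 0 g u in
  let A2 := fun g => Aop a 1 g u in
  let dz := fun g => partial 2 g u in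
  let ddV := fun p q => partial p (partial q V) u in
  [/\ Gamma2 a V f u + Gamma2z_rho a z V rho f u
        = hess_sq a z L1 L2 f u + R_total a z V rho L1 L2 f u,
      RG_ab a z V L1 L2 f u
        = - Gamma1 a f f u + 2^-1 * Gamma1z z f f u
          - A1 V * dz f * A2 f + A2 V * dz f * A1 f
          + (ddV 0 0 + y ^+ 2 / 4 * ddV 2 2 - y * ddV 0 2) * `|A1 f| ^+ 2
          + (ddV 1 1 + x ^+ 2 / 4 * ddV 2 2 + x * ddV 1 2) * `|A2 f| ^+ 2
          + 2 * (ddV 0 1 + x / 2 * ddV 0 2 - y / 2 * ddV 1 2
                 - x * y / 4 * ddV 2 2) * A1 f * A2 f,
      R_zb a z V f u
        = (ddV 0 2 - y / 2 * ddV 2 2) * A1 f * Zop z f u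
          + (ddV 1 2 + x / 2 * ddV 2 2) * Zop z f u * A2 f,
      R_rho a z rho f u = 0
    & [/\ A1 f = partial 0 f u - y / 2 * partial 2 f u,
          A2 f = partial 1 f u + x / 2 * partial 2 f u
        & Zop z f u = partial 2 f u]].
Proof.
move=> a z rho L1 L2 x y A1 A2 dz ddV.
have sa := @smooth_alpha_heis R.
have br g : smooth g ->
    Aop a 1 (Aop a 0 g) u = Aop a 0 (Aop a 1 g) u - partial 2 g u.
  by move=> sg; rewrite Aop_heisC.
split.
- rewrite /R_total Gamma2_heis // Gamma2z_heis // hess_sq_heis // RG_ab_heis //.
  rewrite R_zb_heis // R_rho_heis !sum_ord2 (br _ smoothf) (br _ smoothV).
  by generalize_values; field.
- rewrite RG_ab_heis // !sum_ord2 (br _ smoothf) !real_normK ?num_real //.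
  rewrite Gamma1E /Gamma1z !Zop_heis.
  rewrite {}/A1 {}/A2 {}/dz {}/ddV {}/x {}/y.
  have V00 : Aop a 0 (Aop a 0 V) u = partial 0 (partial 0 V) u
      + u 0 1 ^+ 2 / 4 * partial 2 (partial 2 V) u
      - u 0 1 * partial 0 (partial 2 V) u.
    rewrite Aop_heis0 !partial_Aop_heis0 // !Aop_heis0 (partialC 2 0 smoothV)
      /=.
    by generalize_values; field.
  have V11 : Aop a 1 (Aop a 1 V) u = partial 1 (partial 1 V) u
      + u 0 0 ^+ 2 / 4 * partial 2 (partial 2 V) u
      + u 0 0 * partial 1 (partial 2 V) u.
    rewrite Aop_heis1 !partial_Aop_heis1 // !Aop_heis1 (partialC 2 1 smoothV)
      /=.
    by generalize_values; field.
  (* The last term comes from A_0 acting on x/2. It cancels against the bracket in A_1 A_0 V,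
     leaving the symmetric Hessian coefficient. *)
  have V01 : Aop a 0 (Aop a 1 V) u = partial 0 (partial 1 V) u
      + u 0 0 / 2 * partial 0 (partial 2 V) u
      - u 0 1 / 2 * partial 1 (partial 2 V) u
      - u 0 0 * u 0 1 / 4 * partial 2 (partial 2 V) u + 2^-1 * partial 2 V u.
    rewrite Aop_heis0 !partial_Aop_heis1 // !Aop_heis1.
    rewrite (partialC 2 0 smoothV) (partialC 1 0 smoothV) /=.
    by generalize_values; field.
  rewrite (br _ smoothV) V00 V11 V01.
  by generalize_values; field.
- rewrite R_zb_heis // Zop_heis sum_ord2 [Aop a 0 (partial 2 V)]Aop_heis0.
  rewrite [Aop a 1 (partial 2 V)]Aop_heis1 {}/A1 {}/A2 {}/ddV {}/x {}/y.
  by generalize_values; ring.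
- exact: R_rho_heis.
- split; rewrite ?Zop_heis // /A1 /A2 /x /y ?Aop_heis0 ?Aop_heis1 //.
  by rewrite mulNr.
Qed.
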